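(* Let $X$ be a Banach space over $\mathbb K\in\{\mathbb R,\mathbb C\}$ and let $U \subset X$ be a convex closed bounded balanced set which is aSCD. Then $U$ is SCD.
   Context: $U$ is balanced if $\lambda u\in U$ for all $u\in U$ and all $\lambda\in\mathbb K$ with $|\lambda|\le 1$. For a non-empty bounded set $A \subset X$, a slice of $A$ is a (non-empty) set of the form $S(A,f,\varepsilon)=\{x\in A : f(x) > \sup_{a\in A} f(a)-\varepsilon\}$, where $f\colon X\to\mathbb R$ is a non-zero bounded real-linear functional (in the complex case, $f=\operatorname{Re} x^*$ with $x^*\in X^*$) and $\varepsilon>0$. A bounded set $A\subset X$ is SCD (slicely countably determined) if there is a sequence $(S_n)_{n\in\mathbb N}$ of slices of $A$ such that for every $B\subset X$ with $B\cap S_n\neq\emptyset$ for all $n$ one has $A\subset\overline{\mathrm{conv}}(B)$ (norm-closed convex hull). A bounded set $A\subset X$ is aSCD (almost SCD) if there is a sequence $(S_n)_{n\in\mathbb N}$ of slices of $A$ such that for every $B\subset X$ with $B\cap S_n\neq\emptyset$ for all $n$ one has $A\subset\overline{\mathrm{aconv}}(B)$, where $\mathrm{aconv}(B)$ is the absolutely convex hull with respect to $\mathbb K$, i.e. the smallest convex balanced set containing $B$, and the bar denotes norm closure. *)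

(* Defs.v *)
From HB Require Import structures.
From mathcomp Require Import all_boot all_order all_algebra.
From mathcomp Require Import complex.
From mathcomp Require Import boolp classical_sets functions reals topology.
From mathcomp Require Import convex normedtype.

Set Implicit Arguments.
Unset Strict Implicit.
Unset Printing Implicit Defensive.

Import Order.TTheory GRing.Theory Num.Theory.
Import numFieldNormedType.Exports.

Local Open Scope classical_set_scope.
Local Open Scope ring_scope.

Variant scalar_kind := RealScalars | ComplexScalars.

Definition scalars (R : realType) (k : scalar_kind) : numFieldType :=
  match k with
  | RealScalars => R
  | ComplexScalars => (complex R : numFieldType)
  end.

Definition re_scalar (R : realType) (k : scalar_kind) : scalars R k -> R :=
  match k with
  | RealScalars => fun x : R => x
  | ComplexScalars => fun z : complex R => complex.Re z
  end.

Section SCD.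
Context (R : realType) (k : scalar_kind).
Local Notation K := (scalars R k).
Context (X : normedModType K).
Implicit Types (A B S U : set X) (f : X -> R).

Definition balanced U : Prop :=
  forall (u : X) (lambda : K), U u -> `|lambda| <= 1 -> U (lambda *: u).

Definition conv_hull B : set X := smallest (@convex_set K X) B.

Definition aconv_hull B : set X :=
  smallest [set C : set X | @convex_set K X C /\ balanced C] B.

(* [X^*] is the space of continuous [K]-linear functionals; over the reals
   [re_scalar] is the identity, so that [f] is itself an element of [X^*]. *)
Definition bounded_real_functional f : Prop :=
  exists2 xstar : {linear X -> K^o}, continuous xstar &
    forall x, f x = re_scalar (xstar x).

Definition slice A f (eps : R) : set X :=
  [set x | A x /\ f x > sup (f @` A) - eps].

(* The condition [S !=set0] only matters when [A] is empty: a nonempty bounded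
   set has nonempty slices, and the empty set has no slice at all. *)
Definition is_slice A S : Prop :=
  exists f eps, [/\ bounded_real_functional f, exists x, f x != 0, 0 < eps,
    S = slice A f eps & S !=set0].

Definition SCD A : Prop :=
  bounded_set A /\
  exists S : nat -> set X, (forall n, is_slice A (S n)) /\
    forall B, (forall n, B `&` S n !=set0) -> A `<=` closure (conv_hull B).

Definition aSCD A : Prop :=
  bounded_set A /\
  exists S : nat -> set X, (forall n, is_slice A (S n)) /\
    forall B, (forall n, B `&` S n !=set0) -> A `<=` closure (aconv_hull B).

End SCD.

(* Main.v *)
From HB Require Import structures.
Require Import Defs.
From mathcomp Require Import all_boot all_order all_algebra.
From mathcomp Require Import complex.
From mathcomp Require Import boolp classical_sets functions reals topology.
From mathcomp Require Import convex normedtype.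
From mathcomp Require Import interval_inference ring lra.

Set Implicit Arguments.
Unset Strict Implicit.
Unset Printing Implicit Defensive.

Import Order.TTheory GRing.Theory Num.Theory.
Import numFieldNormedType.Exports.

Local Open Scope classical_set_scope.
Local Open Scope ring_scope.

(** Let S_n be slices witnessing that U is aSCD. The slices witnessing SCD are
    all rotated sets w^-1 S_n, where w runs through the phases of a countable
    dense set of scalars; they are slices of U because U is balanced.

    Suppose B meets every rotated slice and some x in U is at distance at least
    d > 0 from conv B. The separation theorem gives a K-linear functional g of
    norm at most 1 with re (g c) + d <= re (g x) for c in conv B; put
    alpha := max (re (g x) - d, 0), an upper bound of re g on B. The claim
    [aSCD_functional_bound] is that then |g| <= alpha on all of U. If alpha is
    re (g x) - d, this is absurd at x itself; if alpha is 0, then g vanishes on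
    U, hence at x and at a point of B inside a slice of U, which contradicts
    the strict separation.

    For the claim, fix alpha' > alpha. It suffices to find in each S_n a point
    c_n with |g c_n| < alpha': then every u in U is in the closed absolutely
    convex hull of the c_n, where |g| <= alpha'. Now V := g(S_n) is a convex
    set of scalars, and since B meets the rotations of S_n, for a dense set of
    phases w there is v in V with re (w^-1 v) <= alpha. If V avoided the disc of
    radius alpha', separating V from 0 inside K would give a scalar l with
    |l| <= 1 and re (l v) >= alpha' on V, and a member of the dense set close to
    l would contradict this ([exists_small_scalar]).

    Separation is used twice, for X and for K itself. It follows from the
    Mazur-Orlicz form of the Hahn-Banach theorem ([mazur_orlicz]), applied to
    the norm of the underlying real vector space; over the complex numbers the
    real functional f obtained in this way is the real part of
    x |-> f x - i f (i x). *)

(** * Sublinear functionals and the Mazur-Orlicz theorem *)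

Section Sublinear.
Context (R : realType) (V : lmodType R).
Implicit Types (p q f : V -> R) (C : set V) (x y : V) (t s beta : R).

Definition sublinear p : Prop :=
  (forall x y, p (x + y) <= p x + p y) /\
  (forall t x, 0 < t -> p (t *: x) <= t * p x).

Lemma sublinear_ge0 p : sublinear p -> 0 <= p 0.
Proof. by case=> pD _; have := pD 0 0; rewrite addr0; lra. Qed.

Lemma sublinear0 p : sublinear p -> p 0 = 0.
Proof.
move=> sp; apply/eqP; rewrite eq_le sublinear_ge0// andbT.
by have := sp.2 2^-1 0 ltac:(lra); rewrite scaler0; lra.
Qed.

Lemma sublinearN p x : sublinear p -> - p (- x) <= p x.
Proof.
by move=> sp; have := sp.1 x (- x); rewrite subrr sublinear0//; lra.
Qed.

Lemma sublinearZ p t x : sublinear p -> 0 <= t -> p (t *: x) = t * p x.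
Proof.
move=> sp; rewrite le_eqVlt => /predU1P[<-|t0].
  by rewrite scale0r mul0r sublinear0.
apply/eqP; rewrite eq_le sp.2//=.
have := sp.2 t^-1 (t *: x); rewrite invr_gt0 => /(_ t0).
by rewrite scalerA mulVf ?gt_eqF// scale1r ler_pdivlMl.
Qed.

(** The largest sublinear functional below [p] whose value at [- c] is at most
    [- beta] for every [c] in [C], when [C] is nonempty and convex and
    [p >= beta] on [C]. *)
Definition cone_lower p C beta x : R :=
  inf [set r | exists t c, [/\ 0 <= t, C c & r = p (x + t *: c) - t * beta]].

Section ConeLower.
Variables (p : V -> R) (C : set V) (beta : R).
Hypotheses (sp : sublinear p) (C0 : C !=set0) (Cp : forall c, C c -> beta <= p c).

Let lower_lb x : lbound
  [set r | exists t c, [/\ 0 <= t, C c & r = p (x + t *: c) - t * beta]]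
  (- p (- x)).
Proof.
move=> _ [t [c [t0 Cc ->]]].
have := sp.1 (x + t *: c) (- x); rewrite addrAC subrr add0r sublinearZ//.
by have := ler_wpM2l t0 (Cp Cc); lra.
Qed.

Lemma cone_lower_le t c x : 0 <= t -> C c ->
  cone_lower p C beta x <= p (x + t *: c) - t * beta.
Proof.
move=> t0 Cc; apply: ge_inf; last by exists t, c.
by exists (- p (- x)); exact: lower_lb.
Qed.

Lemma le_cone_lower x r :
  (forall t c, 0 <= t -> C c -> r <= p (x + t *: c) - t * beta) ->
  r <= cone_lower p C beta x.
Proof.
move=> h; apply: lb_le_inf; last by move=> _ [t [c [t0 Cc ->]]]; exact: h.
by have [c Cc] := C0; exists (p (x + 0 *: c) - 0 * beta), 0, c.
Qed.

Lemma cone_lower_le_base x : cone_lower p C beta x <= p x.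
Proof.
have [c Cc] := C0.
by have := cone_lower_le x (lexx 0) Cc; rewrite scale0r addr0 mul0r subr0.
Qed.

Lemma cone_lowerN c : C c -> cone_lower p C beta (- c) <= - beta.
Proof.
move=> Cc; have := cone_lower_le (- c) ler01 Cc.
by rewrite scale1r addNr sublinear0// mul1r add0r.
Qed.

(** Convexity of [C] is what gives subadditivity: a sum [t *: c + s *: d] of two
    elements of the cone over [C] is [t + s] times a single element of [C]. *)
Lemma cone_lower_sublinear : convex_set C -> sublinear (cone_lower p C beta).
Proof.
move=> cC; split=> [x y|t x t0].
- rewrite -lerBlDr; apply: le_cone_lower => t c t0 Cc.
  rewrite lerBlDr -lerBlDl; apply: le_cone_lower => s d s0 Cd.
  rewrite lerBlDl.
  have [ts0|ts0] := eqVneq (t + s) 0.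
    have [-> ->] : t = 0 /\ s = 0 by split; lra.
    rewrite !scale0r !addr0 !mul0r !subr0.
    exact: le_trans (cone_lower_le_base _) (sp.1 _ _).
  have tsp : 0 < t + s by rewrite lt_neqAle eq_sym ts0 addr_ge0.
  pose l := t / (t + s).
  have l0 : 0 <= l by rewrite divr_ge0// ltW.
  have l1 : l <= 1 by rewrite ler_pdivrMr// mul1r lerDl.
  have : conv (Itv01 l0 l1) (c : convex_lmodType V) d \in C.
    by apply: cC; rewrite inE.
  rewrite inE => Ce; apply: le_trans (cone_lower_le _ (ltW tsp) Ce) _.
  change (conv _ _ _) with (l *: c + (1 - l) *: d).
  rewrite scalerDr !scalerA.
  have -> : (t + s) * l = t by rewrite /l; field.
  have -> : (t + s) * (1 - l) = s by rewrite /l; field.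
  by rewrite addrACA; have := sp.1 (x + t *: c) (y + s *: d); lra.
- rewrite -ler_pdivrMl//; apply: le_cone_lower => s c s0 Cc.
  rewrite ler_pdivrMl//.
  apply: le_trans (cone_lower_le _ (mulr_ge0 (ltW t0) s0) Cc) _.
  by rewrite -scalerA -scalerDr (sublinearZ _ sp (ltW t0)) mulrBr mulrA.
Qed.

End ConeLower.

(** Minimality forces [p] to coincide with its lowering along a single vector
    [y] with [beta := p y], so that [p (- y) = - p y]; a sublinear functional
    that is odd is linear. *)
Lemma minimal_sublinear_linear p : sublinear p ->
  (forall q, sublinear q -> (forall x, q x <= p x) -> forall x, p x <= q x) ->
  linear (p : V -> R^o).
Proof.
move=> sp minp.
have pN y : p (- y) = - p y.
  have y0 : [set y] !=set0 by exists y.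
  have yp c : [set y] c -> p y <= p c by move=> ->.
  have cy : @convex_set _ V [set y].
    by move=> a b l; rewrite !inE => -> ->; rewrite convmm.
  apply/eqP; rewrite eq_le; apply/andP; split.
    apply: le_trans (cone_lowerN sp yp (erefl y)).
    by apply: minp; [exact: cone_lower_sublinear|move=> x; exact: cone_lower_le_base].
  by have := sublinearN y sp; lra.
have pD x y : p (x + y) = p x + p y.
  apply/eqP; rewrite eq_le sp.1/=.
  by have := sp.1 (x + y) (- y); rewrite addrK pN; lra.
move=> t x y; rewrite pD; congr (_ + _).
have [t0|t0] := leP 0 t; first exact: sublinearZ.
have Nt0 : 0 <= - t by lra.
by rewrite -[t]opprK scaleNr pN (sublinearZ _ sp Nt0) !mulNr !opprK.
Qed.

(** Zorn's lemma for the reverse pointwise order: the infimum of a chain of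
    sublinear functionals below [p] is again one, since at [x + y] the smaller
    of two members of the chain can be used for both [x] and [y], and since all
    of them are at least [- p (- x)] at [x]. *)
Lemma exists_minimal_sublinear p : sublinear p ->
  exists f, [/\ sublinear f, forall x, f x <= p x &
    forall q, sublinear q -> (forall x, q x <= f x) -> forall x, f x <= q x].
Proof.
move=> sp.
pose T := {q : V -> R | sublinear q /\ forall x, q x <= p x}.
pose mkT q (sq : sublinear q) (qp : forall x, q x <= p x) : T :=
  exist _ q (conj sq qp).
pose le_ (q q' : T) : bool := `[< forall x, sval q' x <= sval q x >].
pose p0 := mkT p sp (fun=> lexx _).
have [|||[f [sf fp]] minf] := @ZL_preorder T p0 le_.
- by move=> q; apply/asboolP.
- move=> r s t /asboolP h1 /asboolP h2; apply/asboolP => x.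
  exact: le_trans (h2 x) (h1 x).
- move=> A tA.
  have [[a Aa]|A0] := pselect (A !=set0); last first.
    by exists p0 => s As; exfalso; apply: A0; exists s.
  pose E x := [set sval q x | q in A].
  have lbE x : lbound (E x) (- p (- x)).
    move=> _ [[q [sq qp]] _ <-] /=.
    by have := sublinearN x sq; have := qp (- x); lra.
  have lE (q : T) x : A q -> inf (E x) <= sval q x.
    move=> Aq; apply: ge_inf; last by exists q.
    by exists (- p (- x)).
  have gE x r : (forall q : T, A q -> r <= sval q x) -> r <= inf (E x).
    move=> h; apply: lb_le_inf; first by exists (sval a x), a.
    by move=> _ [q Aq <-]; exact: h.
  have si : sublinear (fun x => inf (E x)).
    split=> [x y|t x t0].
    + rewrite -lerBlDr; apply: (gE) => q Aq; rewrite lerBlDr -lerBlDl.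
      apply: (gE) => r Ar; rewrite lerBlDl.
      have [/asboolP qr|/asboolP rq] := tA _ _ Aq Ar.
      * apply: le_trans (lE r _ Ar) _.
        by have := (proj1 (svalP r)).1 x y; have := qr x; lra.
      * apply: le_trans (lE q _ Aq) _.
        by have := (proj1 (svalP q)).1 x y; have := rq y; lra.
    + rewrite -ler_pdivrMl//; apply: (gE) => q Aq; rewrite ler_pdivrMl//.
      by apply: le_trans (lE q _ Aq) _; exact: (proj1 (svalP q)).2.
  have ip x : inf (E x) <= p x by apply: le_trans (lE a x Aa) _; exact: (proj2 (svalP a)).
  by exists (mkT _ si ip) => q Aq; apply/asboolP => x; exact: lE.
- exists f; split=> // q sq qf.
  have qp x : q x <= p x by exact: le_trans (qf x) (fp x).
  have /asboolP : le_ (mkT q sq qp) (mkT f sf fp).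
    by apply: minf; apply/asboolP.
  exact.
Qed.

(** A minimal sublinear functional below [cone_lower p C beta] is linear and
    inherits the bound at [- c], which by oddness is a lower bound at [c]. *)
Lemma mazur_orlicz p C beta : sublinear p -> convex_set C -> C !=set0 ->
  (forall c, C c -> beta <= p c) ->
  exists2 f : {linear V -> R^o}, forall x, f x <= p x &
    forall c, C c -> beta <= f c.
Proof.
move=> sp cC C0 Cp.
have [f [sf fl minf]] := exists_minimal_sublinear (cone_lower_sublinear sp C0 Cp cC).
pose lf := GRing.isLinear.Build R V R^o *:%R f
  (minimal_sublinear_linear sf minf).
pose F : {linear V -> R^o} := HB.pack (f : V -> R^o) lf.
exists F => [x|c Cc].
  exact: le_trans (fl x) (cone_lower_le_base sp C0 Cp x).
have : F (- c) <= - beta by exact: le_trans (fl _) (cone_lowerN sp Cp Cc).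
by rewrite linearN lerN2.
Qed.

End Sublinear.

(** * Real and complex scalars *)

Section Scalars.
Context (R : realType) (k : scalar_kind).
Local Notation K := (scalars R k).
Local Notation re := (@re_scalar R k).

Definition of_real : R -> K :=
  match k return R -> scalars R k with
  | RealScalars => fun x : R => x
  | ComplexScalars => fun x : R => Complex x 0
  end.

Lemma of_realB : {morph of_real : x y / x - y}.
Proof. by rewrite /of_real; case: k => //= x y; exact: (rmorphB (real_complex R)). Qed.

Lemma of_realM : {morph of_real : x y / x * y}.
Proof. by rewrite /of_real; case: k => //= x y; exact: (rmorphM (real_complex R)). Qed.

Lemma of_real1 : of_real 1 = 1.
Proof. by rewrite /of_real; case: k. Qed.

HB.instance Definition _ := GRing.isZmodMorphism.Build R K of_real of_realB.
HB.instance Definition _ :=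
  GRing.isMonoidMorphism.Build R K of_real (of_real1, of_realM).

Lemma of_realD : {morph of_real : x y / x + y}.
Proof. exact: rmorphD. Qed.

Lemma re_scalarB : {morph re : x y / x - y}.
Proof. by rewrite /re_scalar; case: k => //= -[a b] [c d]. Qed.

HB.instance Definition _ := GRing.isZmodMorphism.Build K R re re_scalarB.

Lemma of_realK : cancel of_real re.
Proof. by rewrite /of_real /re_scalar; case: k. Qed.

Lemma re_scalarM r z : re (of_real r * z) = r * re z.
Proof.
rewrite /of_real /re_scalar; move: z; case: k => //= -[a b] /=.
by rewrite mul0r subr0.
Qed.

Lemma ler_of_real : {mono of_real : r s / r <= s}.
Proof. by rewrite /of_real; case: k => //= r s; exact: lecR. Qed.

Lemma ger0_of_real (z : K) : 0 <= z -> z = of_real (re z).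
Proof.
rewrite /of_real /re_scalar; move: z; case: k => //= z z0.
by rewrite [LHS]complexE (ger0_Im z0) mulr0 addr0.
Qed.

Lemma re_scalar_le_norm (z : K) : re z <= re `|z|.
Proof.
rewrite /re_scalar; move: z; case: k => /= z; first exact: ler_norm.
have := normc_ge_Re z; rewrite lecE => /andP[_] /=.
exact: le_trans (ler_norm _).
Qed.

Lemma ler_re (z w : K) : 0 <= w -> z <= w -> re z <= re w.
Proof.
move=> /ger0_of_real ->; rewrite of_realK.
move: (re w) => r; clear w; move: z r; rewrite /of_real /re_scalar.
case: k => //= z r.
by rewrite lecE => /andP[_].
Qed.

Lemma scalars_separable : exists a : nat -> K,
  forall (z : K) e, 0 < e -> exists n, re `|z - a n| < e.
Proof.
have ratR (x e : R) : 0 < e -> exists q : rat, `|x - ratr q| < e.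
  move=> e0.
  have /rat_in_itvoo[q] : x - e < x + e by lra.
  rewrite in_itv/= => /andP[h1 h2]; exists q.
  by rewrite ltr_norml; apply/andP; split; lra.
have enum (T : countType) (f : T -> K) (t0 : T) :
    (forall (z : K) e, 0 < e -> exists t, re `|z - f t| < e) ->
    exists a : nat -> K,
      forall (z : K) e, 0 < e -> exists n, re `|z - a n| < e.
  move=> h; exists (fun n => f (odflt t0 (unpickle n))) => z e /(h z)[t ht].
  by exists (pickle t); rewrite pickleK.
move: enum; rewrite /re_scalar; case: k => /= enum.
- by apply: (enum _ (fun q : rat => ratr q) 0) => z e; exact: ratR.
- apply: (enum _ (fun q : rat * rat => Complex (ratr q.1) (ratr q.2)) (0, 0)).
  move=> [x y] e e0.
  have e20 : 0 < e / 2 by lra.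
  have [[q hq] [r hr]] := (ratR x _ e20, ratR y _ e20).
  exists (q, r); rewrite /=.
  rewrite -[ltRHS](ger0_norm (ltW e0)) -sqrtr_sqr ltr_sqrt ?exprn_gt0//.
  move: hq hr; rewrite !ltr_norml => /andP[h1 h2] /andP[h3 h4]; nra.
Qed.

Lemma norm_of_real (V : normedZmodType K) (x : V) : `|x| = of_real (re `|x|).
Proof. exact: ger0_of_real. Qed.

Lemma re_norm_ge0 (V : normedZmodType K) (x : V) : 0 <= re `|x|.
Proof. by rewrite -ler_of_real -norm_of_real rmorph0. Qed.

Lemma ler_re_norm (V W : normedZmodType K) (x : V) (y : W) :
  (re `|x| <= re `|y|) = (`|x| <= `|y|).
Proof. by rewrite -ler_of_real -!norm_of_real. Qed.

Lemma ltr_re_norm (V : normedZmodType K) (x : V) (e : K) :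
  0 <= e -> (re `|x| < re e) = (`|x| < e).
Proof.
move=> e0; rewrite [in RHS](ger0_of_real e0) [in RHS]norm_of_real.
by rewrite (leW_mono ler_of_real).
Qed.

Lemma re_normD (V : normedZmodType K) (x y : V) :
  re `|x + y| <= re `|x| + re `|y|.
Proof. by rewrite -raddfD ler_re ?addr_ge0//; exact: ler_normD. Qed.

Lemma re_normZ (V : normedModType K) (t : R) (x : V) : 0 <= t ->
  re `|of_real t *: x| = t * re `|x|.
Proof.
move=> t0; rewrite normrZ ger0_norm; first by rewrite re_scalarM.
by rewrite -(rmorph0 of_real) ler_of_real.
Qed.

(** The unimodular factor rotating [z] onto the nonnegative half-line; the value
    [1] at [z = 0] keeps [norm_unphase] and [unphaseM] unconditional. *)
Definition unphase (z : K) : K := if z == 0 then 1 else `|z| / z.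

Lemma norm_unphase z : `|unphase z| = 1.
Proof.
rewrite /unphase; case: eqVneq => [_|z0]; first exact: normr1.
by rewrite normrM normfV normr_id divff// normr_eq0.
Qed.

Lemma unphaseM z : unphase z * z = `|z|.
Proof.
rewrite /unphase; case: eqVneq => [->|z0]; first by rewrite mulr0 normr0.
by rewrite divfK.
Qed.

Lemma unphase_neq0 z : unphase z != 0.
Proof. by rewrite -normr_eq0 norm_unphase oner_eq0. Qed.

(** In the complex case the order is partial, but a coefficient between [0] and
    [1] is real, so convexity only involves real coefficients. *)
Lemma convexP (X : lmodType K) (C : set X) :
  @convex_set K X C <-> forall t c d, 0 <= t -> t <= 1 -> C c -> C d ->
  C (of_real t *: c + of_real (1 - t) *: d).
Proof.
split=> [cC t c d t0 t1 Cc Cd|cC c d l].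
- have l0 : 0 <= of_real t by rewrite -(rmorph0 of_real) ler_of_real.
  have l1 : of_real t <= 1 by rewrite -(rmorph1 of_real) ler_of_real.
  have := cC c d (Itv01 l0 l1); rewrite !inE => /(_ Cc Cd).
  by rewrite rmorphB rmorph1.
- rewrite !inE => Cc Cd.
  change (C (l%:num *: c + (1 - l%:num) *: d)).
  have l0 : 0 <= l%:num by [].
  have l1 : l%:num <= 1 by [].
  move: (l%:num) l0 l1 => t t0 t1; rewrite (ger0_of_real t0).
  rewrite -(rmorph1 of_real) -rmorphB; apply: cC => //.
    by rewrite -ler_of_real rmorph0 -ger0_of_real.
  by rewrite -ler_of_real rmorph1 -ger0_of_real.
Qed.

(** An alias, so that the underlying real vector space of [X] carries its own
    scaling while [X] keeps the one over [K]. *)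
Definition realified (X : lmodType K) : Type := X.

HB.instance Definition _ (X : lmodType K) := GRing.Zmodule.on (realified X).

Section Realified.
Variable X : lmodType K.

Definition realified_scale (r : R) (x : realified X) : realified X :=
  of_real r *: (x : X).

Lemma realified_scaleA a b v :
  realified_scale a (realified_scale b v) = realified_scale (a * b) v.
Proof. by rewrite /realified_scale scalerA rmorphM. Qed.

Lemma realified_scale1 : left_id 1 realified_scale.
Proof. by move=> v; rewrite /realified_scale rmorph1 scale1r. Qed.

Lemma realified_scaleDr : right_distributive realified_scale +%R.
Proof. by move=> a u v; exact: scalerDr. Qed.

Lemma realified_scaleDl v :
  {morph realified_scale^~ v : a b / a + b}.
Proof. by move=> a b; rewrite /realified_scale rmorphD scalerDl. Qed.

HB.instance Definition _ := GRing.Zmodule_isLmodule.Build R (realified X)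
  realified_scaleA realified_scale1 realified_scaleDr realified_scaleDl.

End Realified.

End Scalars.

(** Over the complex numbers, [g x := f x - i f (i x)]. *)
Lemma linear_of_re (R : realType) (k : scalar_kind) (X : lmodType (scalars R k))
    (f : {linear realified X -> R^o}) :
  exists g : {linear X -> (scalars R k)^o}, forall x, re_scalar (g x) = f x.
Proof.
have fD (x y : X) : f (x + y : X) = f x + f y by exact: linearD.
have fZ r (x : X) : f (of_real k r *: x : X) = r * f x by exact: linearZ.
move: (f : X -> R) fD fZ => {f}; case: k X => X f fD fZ.
- have lf : linear (f : X -> (scalars R RealScalars)^o).
    by move=> r x y; rewrite fD fZ.
  pose F := GRing.isLinear.Build _ X _ *:%R (f : X -> (scalars R RealScalars)^o) lf.
  by exists (HB.pack (f : X -> (scalars R RealScalars)^o) F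
    : {linear X -> (scalars R RealScalars)^o}).
- pose i : scalars R ComplexScalars := Complex 0 1.
  pose g (x : X) : (scalars R ComplexScalars)^o := Complex (f x) (- f (i *: x)).
  have lg : linear g.
    move=> [a b] x y.
    have abE (z : X) : (Complex a b : scalars R ComplexScalars) *: z =
        of_real ComplexScalars a *: z + of_real ComplexScalars b *: (i *: z).
      rewrite scalerA -scalerDl; congr (_ *: _).
      by rewrite /of_real /i; simpc.
    have iab : i *: ((Complex a b : scalars R ComplexScalars) *: x) =
        of_real ComplexScalars a *: (i *: x) + of_real ComplexScalars (- b) *: x.
      rewrite !scalerA -scalerDl; congr (_ *: _).
      by rewrite /of_real /i; simpc.
    rewrite /g scalerDr iab abE !fD !fZ.
    apply/eqP; rewrite eq_complex /=; apply/andP; split; apply/eqP; ring.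
  pose F := GRing.isLinear.Build _ X _ *:%R g lg.
  by exists (HB.pack g F : {linear X -> (scalars R ComplexScalars)^o}).
Qed.

(** * Separation from a convex set at positive distance *)

Section Separation.
Context (R : realType) (k : scalar_kind).
Local Notation K := (scalars R k).
Local Notation re := (@re_scalar R k).
Context (X : normedModType K).
Implicit Types (C : set X) (x : X).

Lemma re_norm_sublinear : sublinear (fun x : realified X => re `|x : X|).
Proof.
split=> [x y|t x t0]; first exact: re_normD.
by rewrite -re_normZ// ltW.
Qed.

(** Rotate [x] so that [g x] becomes its own modulus, hence its real part. *)
Lemma norm_le_of_re (g : {linear X -> K^o}) :
  (forall x, re (g x) <= re `|x|) -> forall x, `|g x| <= `|x|.
Proof.
move=> h x; rewrite -ler_re_norm.
have := h (unphase (g x) *: x); rewrite linearZ /= normrZ norm_unphase mul1r.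
by rewrite [_ *: _]unphaseM.
Qed.

Lemma convex_set_realified_subr C x0 : @convex_set K X C ->
  @convex_set R (realified X) [set x0 - c | c in C].
Proof.
move=> /convexP cC _ _ l /[!inE] -[c Cc <-] [d Cd <-].
have l0 : 0 <= l%:num by [].
have l1 : l%:num <= 1 by [].
eexists; first exact: cC l0 l1 Cc Cd.
change (x0 - (of_real k l%:num *: c + of_real k (1 - l%:num) *: d) =
  of_real k l%:num *: (x0 - c) + of_real k (1 - l%:num) *: (x0 - d)).
by rewrite !scalerBr addrACA -scalerDl -of_realD subrKC of_real1 scale1r opprD.
Qed.

(** The Mazur-Orlicz theorem for the norm and the convex set [x0 - C], on which
    the norm is at least [d]; the resulting functional is dominated by the norm,
    which is the bound on [g]. *)
Lemma separation C x0 d : @convex_set K X C -> C !=set0 ->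
  (forall c, C c -> d <= re `|x0 - c|) ->
  exists2 g : {linear X -> K^o}, forall x, `|g x| <= `|x| &
    forall c, C c -> re (g c) + d <= re (g x0).
Proof.
move=> cC [c0 Cc0] Cd.
have [||f fn fC] := mazur_orlicz (beta := d) re_norm_sublinear
  (convex_set_realified_subr (x0 := x0) cC).
- by exists (x0 - c0), c0.
- by move=> _ [c Cc <-]; exact: Cd.
have [g gf] := linear_of_re f.
exists g => [x|c Cc].
  by apply: norm_le_of_re => y; rewrite gf; exact: fn.
have : d <= f (x0 - c) by apply: fC; exists c.
by rewrite -gf linearB raddfB; lra.
Qed.

End Separation.

(** * Slices of a balanced convex set *)

Section Slices.
Context (R : realType) (k : scalar_kind).
Local Notation K := (scalars R k).
Local Notation re := (@re_scalar R k).
Context (X : normedModType K).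
Implicit Types (U S B C : set X) (x : X) (g : {linear X -> K^o}).

Lemma balanced_unitE U w x : balanced U -> `|w| = 1 -> U (w *: x) = U x.
Proof.
move=> bU w1; apply/propext; split=> Ux; last by apply: bU; rewrite ?w1.
have w0 : w != 0 by rewrite -normr_eq0 w1 oner_eq0.
by rewrite -[x](scalerK w0); apply: bU => //; rewrite normfV w1 invr1.
Qed.

(** Since [U] is invariant under rotations, rotating the functional changes
    neither its supremum over [U] nor the width of the slice. *)
Lemma is_slice_rotate U S w : balanced U -> `|w| = 1 -> is_slice U S ->
  is_slice U [set x | S (w *: x)].
Proof.
move=> bU w1 [f [e [[g gc fg] [x0 fx0] e0 ->]]] [y [Uy fy]].
have w0 : w != 0 by rewrite -normr_eq0 w1 oner_eq0.
exists (fun x => f (w *: x)), e; split=> //.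
- exists (w \*: g)%R => [x|x].
    by apply: cvgZr; exact: gc.
  by rewrite fg linearZ.
- by exists (w^-1 *: x0); rewrite scalerKV.
- have fU : (fun x => f (w *: x)) @` U = f @` U.
    apply/seteqP; split=> _ [x Ux <-].
      by exists (w *: x) => //; rewrite balanced_unitE.
    exists (w^-1 *: x); last by rewrite scalerKV.
    by rewrite -(balanced_unitE _ bU w1) scalerKV.
  by rewrite /slice fU; apply/seteqP; split=> x /=; rewrite balanced_unitE.
- by exists (w^-1 *: y); rewrite /slice /= scalerKV.
Qed.

Lemma is_slice_convex U S : @convex_set K X U -> is_slice U S ->
  @convex_set K X S.
Proof.
move=> /convexP cU [f [e [[g _ fg] _ _ -> _]]]; apply/convexP.
move=> t c d t0 t1 [Uc fc] [Ud fd]; split; first exact: cU.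
rewrite fg linearD !linearZ raddfD /= !re_scalarM -!fg.
move: (sup _) fc fd => s fc fd; have t1' : 0 <= 1 - t by lra.
by have [cd|/ltW dc] := leP (f c) (f d); nra.
Qed.

End Slices.

(** * Small values of a functional on a slice *)

Section Core.
Context (R : realType) (k : scalar_kind).
Local Notation K := (scalars R k).
Local Notation re := (@re_scalar R k).

Lemma image_linear_convex (X : normedModType K) (C : set X)
    (g : {linear X -> K^o}) :
  @convex_set K X C -> @convex_set K K^o (g @` C).
Proof.
move=> /convexP cC; apply/(convexP (X := K^o)) => t _ _ t0 t1 [c Cc <-] [d Cd <-].
exists (of_real k t *: c + of_real k (1 - t) *: d); first exact: cC.
by rewrite linearD !linearZ.
Qed.

(** A convex set of scalars that avoids the open disc of radius [alpha'] lies,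
    for some [l] with [`|l| <= 1], in the half-plane [alpha' <= re (l * v)]. If
    [a n] is close to [l], no [v] with [`|v| <= M] lies both there and in the
    half-plane [re ((unphase (a n))^-1 * v) <= alpha]. *)
Lemma exists_small_scalar (a : nat -> K) (V : set K^o) (M alpha alpha' : R) :
  (forall (z : K) e, 0 < e -> exists n, re `|z - a n| < e) ->
  @convex_set K K^o V -> (forall v, V v -> re `|v| <= M) ->
  0 <= alpha -> alpha < alpha' ->
  (forall n, exists2 v, V v & re ((unphase (a n))^-1 * v) <= alpha) ->
  exists2 v, V v & re `|v| < alpha'.
Proof.
move=> da cV VM a0 aa' Va; apply: contrapT => noV.
have Vbig v : V v -> alpha' <= re `|(0 : K^o) - v|.
  by move=> Vv; rewrite sub0r normrN leNgt; apply/negP => h; apply: noV; exists v.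
have V0 : V !=set0 by have [v Vv _] := Va 0; exists v.
have [g gn gV] := separation cV V0 Vbig.
pose l : K := - g 1.
have l1 : `|l| <= 1 by rewrite normrN (le_trans (gn _))// normr1.
have lV v : V v -> alpha' <= re (l * v).
  move=> /gV; rewrite linear0 raddf0 mulNr raddfN.
  have -> : g v = g 1 * v by rewrite -[X in g X]mulr1 [LHS]linearZ /= mulrC.
  by lra.
have M0 : 0 <= M.
  by have [v Vv] := V0; exact: le_trans (re_norm_ge0 v) (VM v Vv).
have N0 : 0 < alpha + M + 1 by lra.
(* An error [e] below this tolerance gives [(1 + e) * alpha + e * M < alpha']. *)
have [n ln] := da l ((alpha' - alpha) / (alpha + M + 1))
  ltac:(by rewrite divr_gt0// subr_gt0).
have [v Vv va] := Va n.
have := lV v Vv.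
have qn : re `|a n| <= 1 + re `|l - a n|.
  have : re `|a n| <= re (`|l| + `|l - a n|).
    rewrite ler_re// ?addr_ge0//.
    by rewrite -[X in `|X| <= _](subKr l) (le_trans (ler_normB _ _)).
  have : re `|l| <= 1.
    by rewrite -(@ler_of_real R k) -norm_of_real rmorph1.
  by rewrite raddfD; lra.
have qv : re (a n * v) <= re `|a n| * alpha.
  have -> : a n * v = `|a n| * ((unphase (a n))^-1 * v).
    by rewrite -unphaseM mulrA [unphase _ * _]mulrC mulfK// unphase_neq0.
  by rewrite norm_of_real re_scalarM -norm_of_real ler_wpM2l// re_norm_ge0.
have dv : re ((l - a n) * v) <= re `|l - a n| * M.
  apply: le_trans (re_scalar_le_norm _) _.
  by rewrite normrM norm_of_real re_scalarM of_realK ler_wpM2l ?VM// re_norm_ge0.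
have -> : re (l * v) = re (a n * v) + re ((l - a n) * v).
  by rewrite -raddfD -mulrDl subrKC.
rewrite ltr_pdivlMr// in ln.
have e0 := re_norm_ge0 (l - a n).
move: (re `|l - a n|) (re `|a n|) (re (a n * v)) (re _) ln e0 qn qv dv => e q s t.
nra.
Qed.

End Core.

(** * From almost SCD to SCD *)

Section Main.
Context (R : realType) (k : scalar_kind).
Local Notation K := (scalars R k).
Local Notation re := (@re_scalar R k).
Context (X : normedModType K).
Implicit Types (U S B C : set X) (x : X) (g : {linear X -> K^o}).

Lemma closure_distP C x :
  closure C x <-> forall d, 0 < d -> exists2 c, C c & re `|x - c| < d.
Proof.
split=> [clC d d0|dC A /nbhs_ballP[e /= e0 eA]].
- have dK : 0 < of_real k d.
    by rewrite -(rmorph0 (@of_real R k)) (leW_mono (@ler_of_real R k)).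
  have [c [Cc]] := clC _ (nbhsx_ballx x (of_real k d) dK).
  rewrite -ball_normE /= -ltr_re_norm ?ltW// of_realK.
  by exists c.
- have re0 : 0 < re e.
    rewrite -(leW_mono (@ler_of_real R k)) rmorph0 -ger0_of_real//.
    exact: ltW.
  have [c Cc xc] := dC _ re0; exists c; split=> //; apply: eA.
  by rewrite -ball_normE /= -ltr_re_norm ?ltW.
Qed.

Lemma conv_hull_convex B : @convex_set K X (conv_hull B).
Proof.
apply/convexP => t c d t0 t1 Bc Bd A [cA BA].
have /convexP := cA; apply=> //; [exact: Bc|exact: Bd].
Qed.

(** The sublevel set [re `|g y| <= alpha] is convex and balanced, and it is
    closed because [g] is a contraction. *)
Lemma closure_aconv_norm_le g B (alpha : R) x : (forall y, `|g y| <= `|y|) ->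
  (forall b, B b -> re `|g b| <= alpha) ->
  closure (aconv_hull B) x -> re `|g x| <= alpha.
Proof.
move=> gn Ba /closure_distP clx.
have aB y : aconv_hull B y -> re `|g y| <= alpha.
  move=> /(_ [set y | re `|g y| <= alpha]); apply; split=> //; split.
    apply/convexP => t c d t0 t1 /= ca da.
    rewrite linearD !linearZ; apply: le_trans (re_normD _ _) _.
    by rewrite !re_normZ ?subr_ge0//; nra.
  move=> u l /= ua l1; apply: le_trans ua.
  rewrite ler_re_norm linearZ normrZ.
  by rewrite ler_piMl.
rewrite leNgt; apply/negP => h.
have [y /aB ya xy] := clx (re `|g x| - alpha) ltac:(lra).
have : re `|g x| <= re `|g y| + re `|g (x - y)|.
  by rewrite -[X in g X](subrKC y x) linearD; exact: re_normD.
have : re `|g (x - y)| <= re `|x - y| by rewrite ler_re_norm.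
lra.
Qed.

Lemma bounded_set_re U : bounded_set U ->
  exists M : R, forall x, U x -> re `|x| <= M.
Proof.
move=> /pinfty_ex_gt0[M _ UM]; exists (re M) => x Ux.
have xM : `|x| <= M by exact: UM.
by rewrite ler_re// (le_trans _ xM).
Qed.

(** The points [c n] of [S n] with [re `|g (c n)| < alpha + e] come from the
    images [g @` S n] by [exists_small_scalar]; the absolutely convex hull of
    these points is dense in [U]. *)
Lemma aSCD_functional_bound U (S : nat -> set X) (a : nat -> K) B g alpha :
  @convex_set K X U -> bounded_set U -> (forall n, is_slice U (S n)) ->
  (forall B, (forall n, B `&` S n !=set0) -> U `<=` closure (aconv_hull B)) ->
  (forall (z : K) e, 0 < e -> exists n, re `|z - a n| < e) ->
  (forall n i, B `&` [set x | S n (unphase (a i) *: x)] !=set0) ->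
  (forall x, `|g x| <= `|x|) -> 0 <= alpha ->
  (forall b, B b -> re (g b) <= alpha) ->
  forall x, U x -> re `|g x| <= alpha.
Proof.
move=> cU /bounded_set_re[M UM] Ssl SU da BS gn a0 Ba x Ux.
apply/ler_addgt0Pr => e e0.
have /choice[c Sc] : forall n, exists c, S n c /\ re `|g c| < alpha + e.
  move=> n.
  have SnU : S n `<=` U by have [f [eps [_ _ _ -> _]]] := Ssl n; move=> y [].
  have [|v [c Sc <-]||||v [c Sc <-] vlt] :=
    @exists_small_scalar R k a (g @` S n) M alpha (alpha + e) da.
  - exact: image_linear_convex (is_slice_convex cU (Ssl n)).
  - by apply: le_trans (UM c (SnU _ Sc)); rewrite ler_re_norm.
  - exact: a0.
  - lra.
  - move=> i; have [b [Bb Sb]] := BS n i.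
    exists (g (unphase (a i) *: b)); first by exists (unphase (a i) *: b).
    by rewrite linearZ [_ * _](mulKf (unphase_neq0 _)) Ba.
  - by exists c.
apply: (@closure_aconv_norm_le g (range c)) => //.
- by move=> _ [n _ <-]; exact/ltW/(proj2 (Sc n)).
- apply: SU => // n; exists (c n); split; [by exists n|exact: (proj1 (Sc n))].
Qed.

(** The rotated slices are indexed by pairs (slice, phase). The bound
    [Num.max (re (g x) - d) 0] of [g] on [U] is tested at the badly approximated
    point [x] and at a point [b] of [B] in [U]: the latter is what excludes
    the case where the maximum is [0]. *)
Lemma balanced_aSCD_SCD U : @convex_set K X U -> balanced U -> aSCD U -> SCD U.
Proof.
move=> cU bU [bdU [S [Ssl SU]]]; split=> //.
have [a da] := scalars_separable R k.
pose dec m : nat * nat := odflt (0, 0)%N (unpickle m).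
pose T m := [set x | S (dec m).1 (unphase (a (dec m).2) *: x)].
exists T; split=> [m|B BT].
  by apply: is_slice_rotate => //; exact: norm_unphase.
have BS n i : B `&` [set x | S n (unphase (a i) *: x)] !=set0.
  by have := BT (pickle (n, i)); rewrite /T /dec pickleK.
move=> x Ux; apply/closure_distP => d d0; apply: contrapT => noC.
have Cd c : conv_hull B c -> d <= re `|x - c|.
  by move=> Cc; rewrite leNgt; apply/negP => h; apply: noC; exists c.
have subC b : B b -> conv_hull B b by move=> Bb A [_]; exact.
have [b [Bb Sb]] := BT 0.
have Ub : U b.
  have [f [eps [_ _ _ E _]]] :=
    is_slice_rotate bU (norm_unphase (a (dec 0).2)) (Ssl (dec 0).1).
  have : slice U f eps b by rewrite -E.
  by case.
have [g gn gB] := separation (@conv_hull_convex B) (ex_intro _ b (subC b Bb)) Cd.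
have al0 : 0 <= Num.max (re (g x) - d) 0 by rewrite le_max lexx orbT.
have gal y : U y -> re `|g y| <= Num.max (re (g x) - d) 0.
  apply: (aSCD_functional_bound cU bdU Ssl SU da BS gn al0) => c /subC/gB h.
  by rewrite le_max; apply/orP; left; lra.
have gx := gal x Ux; have gb := gal b Ub.
have gxn := re_scalar_le_norm (g x).
have := gB b (subC b Bb).
have := re_scalar_le_norm (- g b); rewrite normrN raddfN.
move: gx gb; rewrite /Num.max; case: ltP; lra.
Qed.

End Main.

Theorem theorem4p5 (R : realType) (k : scalar_kind)
    (X : completeNormedModType (scalars R k)) (U : set X) :
  convex_set (U : set (convex_lmodType X)) -> closed U -> bounded_set U ->
  balanced U -> aSCD U -> SCD U.
Proof. by move=> cU _ _ bU; exact: balanced_aSCD_SCD. Qed.
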